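(* Let $w$ be a finite string over $\{0,1\}$. If $w0$ and $w1$ are both colourable, then $\psi(w0)=\psi(w1)$. If $0w$ and $1w$ are both colourable, then $\psi(0w)=\psi(1w)$.
   Context: $\#w$ is the length, $\varepsilon$ the empty string; for $\#w\ge1$, $l(w)$ is $w$ without its last letter and $r(w)$ is $w$ without its first letter. $T^n$ is the alternating string of length $n$ starting with $0$ ($T^0=\varepsilon$, $T^n=T^{n-1}0$ for odd $n$, $T^n=T^{n-1}1$ for even $n\ge2$) and $CT^n$ its letterwise complement. $\xi$: $\xi(\varepsilon)=0$; $\xi(w)=1$ if $w=T^k$, $k\ge2$ even; $\xi(w)=-1$ if $w=CT^k$, $k\ge2$ even; otherwise $\xi(w)=\operatorname{sgn}(\xi(l(w))+\xi(r(w)))$. $\phi$: $\phi(\varepsilon)=0$; $\phi(w)=-1$ if $w=0^k$, $k$ odd; $\phi(w)=1$ if $w=1^k$, $k$ odd; otherwise $\phi(w)=\operatorname{sgn}(\phi(r(w))-\phi(l(w)))$. $\psi(w)=\xi(w)^{\#w}\phi(w)$ (with $0^0=1$); $w$ is colourable iff $\psi(w)\ne0$. *)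

(* Defs.v *)
From mathcomp Require Import all_boot all_order all_algebra.

Set Implicit Arguments.
Unset Strict Implicit.
Unset Printing Implicit Defensive.

Import Order.TTheory GRing.Theory Num.Theory.
Local Open Scope ring_scope.

(* Strings over {0,1}: the letter 0 is [false], the letter 1 is [true]. *)
Definition bstring := seq bool.

Definition del_last (w : bstring) : bstring :=
  if w is a :: s then belast a s else [::].

Definition del_first (w : bstring) : bstring := behead w.

Fixpoint altT (n : nat) : bstring :=
  if n is m.+1 then rcons (altT m) (~~ odd m.+1) else [::].

Definition altCT (n : nat) : bstring := map negb (altT n).

(* The strings T^k, CT^k, 0^k, 1^k have length k, so k can only be [size w] in
   the tests below. *)
Definition is_even_T (w : bstring) : bool :=
  [&& 2 <= size w, ~~ odd (size w) & w == altT (size w)]%N.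

Definition is_even_CT (w : bstring) : bool :=
  [&& 2 <= size w, ~~ odd (size w) & w == altCT (size w)]%N.

Definition is_odd_const (a : bool) (w : bstring) : bool :=
  odd (size w) && (w == nseq (size w) a).

(* xi and phi recurse on strings that are shorter by one letter; [n] bounds the
   recursion depth. The recursion equations are proved below. *)
Fixpoint xi_rec (n : nat) (w : bstring) : int :=
  if n is m.+1 then
    if w == [::] then 0
    else if is_even_T w then 1
    else if is_even_CT w then -1
    else Num.sg (xi_rec m (del_last w) + xi_rec m (del_first w))
  else 0.

Definition xi (w : bstring) : int := xi_rec (size w) w.

Fixpoint phi_rec (n : nat) (w : bstring) : int :=
  if n is m.+1 then
    if w == [::] then 0
    else if is_odd_const false w then -1
    else if is_odd_const true w then 1
    else Num.sg (phi_rec m (del_first w) - phi_rec m (del_last w))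
  else 0.

Definition phi (w : bstring) : int := phi_rec (size w) w.

(* In MathComp [0 ^+ 0 = 1]. *)
Definition psi (w : bstring) : int := xi w ^+ size w * phi w.

Definition colourable (w : bstring) : Prop := psi w <> 0.

Lemma size_altT n : size (altT n) = n.
Proof. by elim: n => //= n IHn; rewrite size_rcons IHn. Qed.

Lemma is_even_TP w :
  reflect (exists k, [/\ (2 <= k)%N, ~~ odd k & w = altT k]) (is_even_T w).
Proof.
apply: (iffP and3P) => [[h1 h2 /eqP h3]|[k [h1 h2 ->]]].
  by exists (size w).
by rewrite size_altT.
Qed.

Lemma is_even_CTP w :
  reflect (exists k, [/\ (2 <= k)%N, ~~ odd k & w = altCT k]) (is_even_CT w).
Proof.
apply: (iffP and3P) => [[h1 h2 /eqP h3]|[k [h1 h2 ->]]].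
  by exists (size w).
by rewrite size_map size_altT.
Qed.

Lemma is_odd_constP a w :
  reflect (exists2 k, odd k & w = nseq k a) (is_odd_const a w).
Proof.
apply: (iffP andP) => [[h1 /eqP h2]|[k h1 ->]]; first by exists (size w).
by rewrite size_nseq.
Qed.

Lemma size_del_last w : size (del_last w) = (size w).-1.
Proof. by case: w => //= a s; rewrite size_belast. Qed.

Lemma size_del_first w : size (del_first w) = (size w).-1.
Proof. exact: size_behead. Qed.

Lemma xi_nil : xi [::] = 0.
Proof. by []. Qed.

Lemma xi_eq w : w <> [::] ->
  xi w = if is_even_T w then 1
         else if is_even_CT w then -1
         else Num.sg (xi (del_last w) + xi (del_first w)).
Proof.
by case: w => // a s _; rewrite /xi size_del_last size_del_first.
Qed.

Lemma phi_nil : phi [::] = 0.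
Proof. by []. Qed.

Lemma phi_eq w : w <> [::] ->
  phi w = if is_odd_const false w then -1
          else if is_odd_const true w then 1
          else Num.sg (phi (del_first w) - phi (del_last w)).
Proof.
by case: w => // a s _; rewrite /phi size_del_last size_del_first.
Qed.

(* Main.v *)
Require Import Defs.
From mathcomp Require Import all_boot all_order all_algebra.

(** Reversal negates psi, so it suffices to treat right extensions.  For a core
    string [v], the two-step recursion writes the value of [x v b] in terms of
    the values of [v], of [x v] without its last letter and of [v b] without its
    first letter.  If the value of [v] is nonzero it fixes the only possible
    nonzero value of [x v b]; if it is zero, the value of [x v b] is the sign of
    a sum in which only the term of the shorter extension depends on [b].
    Induction then shows that the two extensions never have opposite values.
    The recursion breaks down only next to constant or alternating strings;
    there, one of the two extensions is a palindrome, on which xi vanishes, and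
    phi vanishes as well if the length is even. *)

Set Implicit Arguments.
Unset Strict Implicit.
Unset Printing Implicit Defensive.

Import Order.TTheory GRing.Theory Num.Theory.
Local Open Scope ring_scope.

(** * Sign arithmetic of the two-step recursion *)

Definition trit (x : int) := [\/ x = -1, x = 0 | x = 1].

Lemma trit_sg (x : int) : trit (Num.sg x).
Proof. by case: sgrP => _; constructor. Qed.

Lemma trit_xi w : trit (xi w).
Proof.
case: w => [|a s]; first exact: Or32.
rewrite xi_eq //; case: ifP => _; first exact: Or33.
by case: ifP => _; [exact: Or31 | exact: trit_sg].
Qed.

Lemma trit_phi w : trit (phi w).
Proof.
case: w => [|a s]; first exact: Or32.
rewrite phi_eq //; case: ifP => _; first exact: Or31.
by case: ifP => _; [exact: Or33 | exact: trit_sg].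
Qed.

(** Here [m] stands for the value of the core and [p], [q] for those of the two shorter extensions.
    If [m] is nonzero, both factors lie in {0, -m}. If [m = 0], they are the signs of [p + c] and
    [q + c], which can be opposite only when [c = 0] and [p], [q] are opposite. *)
Lemma sg_sub_step (m c p q : int) :
  trit m -> trit c -> trit p -> trit q -> (m = 0 -> p * q <> -1) ->
  Num.sg (Num.sg (p - m) - Num.sg (m - c)) *
  Num.sg (Num.sg (q - m) - Num.sg (m - c)) <> -1.
Proof.
by case=> ->; case=> ->; case=> ->; case=> -> // /(_ erefl).
Qed.

(** As for [sg_sub_step], except that a nonzero [m] confines both factors to {0, m}. *)
Lemma sg_add_step (m c p q : int) :
  trit m -> trit c -> trit p -> trit q -> (m = 0 -> p * q <> -1) ->
  Num.sg (Num.sg (c + m) + Num.sg (m + p)) *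
  Num.sg (Num.sg (c + m) + Num.sg (m + q)) <> -1.
Proof.
by case=> ->; case=> ->; case=> ->; case=> -> // /(_ erefl).
Qed.

(** * Reversal and alternating strings *)

Lemma del_last_rcons w b : del_last (rcons w b) = w.
Proof. by case: w => //= a s; rewrite belast_rcons. Qed.

Lemma del_last_rev w : del_last (rev w) = rev (del_first w).
Proof. by case: w => // a s; rewrite rev_cons del_last_rcons. Qed.

Lemma del_first_rev w : del_first (rev w) = rev (del_last w).
Proof. by rewrite -[w in RHS]revK del_last_rev revK. Qed.

Lemma rev_cons_rcons_palindrome (x : bool) v :
  rev v = v -> rev (x :: rcons v x) = x :: rcons v x.
Proof. by move=> rv; rewrite rev_cons rev_rcons rv. Qed.

Lemma altT_mkseq n : altT n = mkseq odd n.
Proof.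
by elim: n => //= n ->; rewrite negbK /mkseq -addn1 iotaD map_cat cats1.
Qed.

Lemma altCT_mkseq n : altCT n = mkseq (fun i => ~~ odd i) n.
Proof. by rewrite /altCT altT_mkseq -map_comp. Qed.

Lemma rev_altT n : rev (altT n) = if odd n then altT n else altCT n.
Proof.
(* Reversal sends index [i] to [n - i.+1]; its parity covers both cases in one formula. *)
have -> : (if odd n then altT n else altCT n)
          = mkseq (fun i => odd n (+) odd i.+1) n.
  rewrite altT_mkseq altCT_mkseq; case: (odd n) => //.
  by apply: eq_map => i /=; rewrite negbK.
rewrite altT_mkseq; apply: (@eq_from_nth _ false).
  by rewrite size_rev !size_mkseq.
move=> i; rewrite size_rev size_mkseq => ltin.
rewrite nth_rev size_mkseq // !nth_mkseq ?oddB //.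
by rewrite ltn_subrL (leq_ltn_trans _ ltin).
Qed.

Lemma rev_altCT n : rev (altCT n) = if odd n then altCT n else altT n.
Proof.
rewrite /altCT -map_rev rev_altT; case: ifP => // _.
by rewrite -map_comp -[RHS]map_id; apply: eq_map => b /=; rewrite negbK.
Qed.

Lemma is_even_T_rev w : is_even_T (rev w) = is_even_CT w.
Proof.
rewrite /is_even_T /is_even_CT size_rev.
case: (2 <= size w)%N => //=; case ow: (odd (size w)) => //=.
by rewrite -(inj_eq (can_inj revK)) revK rev_altT ow.
Qed.

Lemma is_even_CT_rev w : is_even_CT (rev w) = is_even_T w.
Proof. by rewrite -is_even_T_rev revK. Qed.

(** The first letters differ. Reversal swaps the two tests in [xi], so [xi_rev] needs them to be
    mutually exclusive. *)
Lemma is_even_T_CTF w : is_even_T w -> is_even_CT w = false.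
Proof.
case/is_even_TP=> [[|[|k]] [] // _ _ ->]; apply/negP.
case/and3P=> _ _ /eqP; rewrite size_altT altT_mkseq altCT_mkseq.
by move/(congr1 (head false)).
Qed.

(** Here [v] is alternating of odd length. Hence a core that is not a palindrome keeps its
    one-letter extensions away from the base cases of [xi]. *)
Lemma is_even_alt_rcons_palindrome v b :
  is_even_T (rcons v b) || is_even_CT (rcons v b) -> rev v = v.
Proof.
case/orP=> /and3P[_]; rewrite size_rcons /= negbK => ov.
  move=> /eqP/(congr1 del_last); rewrite !del_last_rcons => ->.
  by rewrite rev_altT ov.
rewrite /altCT /= map_rcons => /eqP/(congr1 del_last).
by rewrite !del_last_rcons => ->; rewrite (rev_altCT (size v)) ov.
Qed.

Lemma is_even_alt_cons_palindrome v x :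
  is_even_T (x :: v) || is_even_CT (x :: v) -> rev v = v.
Proof.
rewrite -is_even_CT_rev -(is_even_T_rev (x :: v)) orbC rev_cons.
by move/is_even_alt_rcons_palindrome; rewrite revK => /esym.
Qed.

Lemma xi_step w : w <> [::] -> ~~ (is_even_T w || is_even_CT w) ->
  xi w = Num.sg (xi (del_last w) + xi (del_first w)).
Proof. by move=> w0; rewrite xi_eq //; case: is_even_T => //; case: is_even_CT. Qed.

Lemma phi_step w : w <> [::] -> ~~ (odd (size w) && constant w) ->
  phi w = Num.sg (phi (del_first w) - phi (del_last w)).
Proof.
move=> w0 ncw; rewrite phi_eq //.
have ncF a : is_odd_const a w = false.
  apply: contraNF ncw => /is_odd_constP[k ok ->].
  by rewrite size_nseq ok constant_nseq.
by rewrite !ncF.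
Qed.

Lemma phi_nseq_odd n a : odd n -> phi (nseq n a) = if a then 1 else -1.
Proof.
case: n => // n on; rewrite phi_eq // /is_odd_const size_nseq on.
by case: a; rewrite eqxx.
Qed.

(** * Behaviour of the three functions under reversal *)

Lemma xi_rev w : xi (rev w) = - xi w.
Proof.
elim: {w}(size w) {-2}w (erefl (size w)) => [|n IHn] w sw.
  by rewrite (size0nil sw).
have w0 : w <> [::] by move=> w0; rewrite w0 in sw.
have rw0 : rev w <> [::] by move=> /(congr1 size); rewrite size_rev sw.
rewrite (xi_eq w0) (xi_eq rw0) is_even_T_rev is_even_CT_rev.
case: (boolP (is_even_T w)) => [/is_even_T_CTF -> // | _].
case: ifP => _ //.
rewrite del_last_rev del_first_rev !IHn ?size_del_first ?size_del_last ?sw //.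
by rewrite -opprD sgrN addrC.
Qed.

(** Reversal exchanges the two terms of the difference, so each letter contributes a factor -1; in
    the base cases the length is odd and the sign is 1. *)
Lemma phi_rev w : phi (rev w) = (-1) ^+ (size w).+1 * phi w.
Proof.
move sw: (size w) => n; elim: n w sw => [|n IHn] w sw.
  by rewrite (size0nil sw) mulr0.
have w0 : w <> [::] by move=> w0; rewrite w0 in sw.
have rw0 : rev w <> [::] by move=> /(congr1 size); rewrite size_rev sw.
have crev a : is_odd_const a (rev w) = is_odd_const a w.
  by rewrite /is_odd_const size_rev -(inj_eq (can_inj revK)) revK rev_nseq.
rewrite (phi_eq w0) (phi_eq rw0) !crev.
have sgn1 a : is_odd_const a w -> (-1) ^+ n.+2 = 1 :> int.
  by case/andP; rewrite sw /= => on _; rewrite -signr_odd /= negbK (negbTE on).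
case: ifP => [/sgn1 ->|_]; first by rewrite mul1r.
case: ifP => [/sgn1 ->|_]; first by rewrite mul1r.
rewrite del_last_rev del_first_rev !IHn ?size_del_first ?size_del_last ?sw //=.
rewrite -mulrBr sgrM sgrX sgrN1 -opprB sgrN.
by rewrite mulrN -mulNr -mulN1r -exprS.
Qed.

(** For length [n], the sign (-1)^n from the power of [xi] and the sign (-1)^(n+1) from [phi]
    multiply to -1. *)
Lemma psi_rev w : psi (rev w) = - psi w.
Proof.
rewrite /psi size_rev xi_rev phi_rev (exprNn (xi w)) mulrACA -exprD addnS exprS.
by rewrite addnn -mul2n exprM sqrrN !expr1n mulr1 mulN1r.
Qed.

(** * Palindromes and one-letter extensions *)

Lemma xi_palindrome w : rev w = w -> xi w = 0.
Proof. by move=> rw; have := xi_rev w; rewrite rw; case: (trit_xi w) => ->. Qed.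

Lemma phi_even_palindrome w : ~~ odd (size w) -> rev w = w -> phi w = 0.
Proof.
move=> ew rw; have := phi_rev w; rewrite rw -signr_odd /= ew mulN1r.
by case: (trit_phi w) => ->.
Qed.

Lemma constant_palindrome (w : bstring) : constant w -> rev w = w.
Proof. by case/(constantP false)=> a ->; rewrite rev_nseq. Qed.

(** For [c] different from [a] the value is that of the single letter [c]: appending two letters [a]
    flips the sign twice, since [phi] is 0 on even blocks of [a] and opposite to the value of [c] on
    odd ones. *)
Lemma phi_cons_nseq_even_neq0 c a k : ~~ odd k -> phi (c :: nseq k a) <> 0.
Proof.
move=> ek; case: (c =P a) => [->|/eqP nca].
  by rewrite (phi_nseq_odd (n := k.+1)) //; case: a.
suff -> : phi (c :: nseq k a) = if c then 1 else -1 by case: c {nca}.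
rewrite -(odd_double_half k) (negbTE ek) add0n {ek}.
have ncaS n : constant (c :: nseq n.+1 a) = false.
  by rewrite /= eq_sym (negbTE nca).
have dl n : del_last (c :: nseq n.+1 a) = c :: nseq n a.
  by rewrite -(del_last_rcons (c :: nseq n a) a) /= -cats1 -(nseqD n 1) addn1.
elim: k./2 => [|j IHj]; first by case: c {nca ncaS dl}.
rewrite doubleS phi_step ?ncaS ?andbF // dl /=.
rewrite (@phi_even_palindrome (nseq j.*2.+2 a)) ?size_nseq ?rev_nseq //=; last first.
  by rewrite negbK odd_double.
rewrite phi_step ?ncaS ?andbF // dl IHj /=.
rewrite (phi_nseq_odd (n := j.*2.+1)) /= ?odd_double //.
by case: c a nca {ncaS dl IHj} => [] [].
Qed.

(** Constant strings of even length are genuine exceptions: their two extensions have values -1 and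
    1. *)
Lemma phi_ext_not_opposite w : odd (size w) || ~~ constant w ->
  phi (rcons w false) * phi (rcons w true) <> -1.
Proof.
have [n] := ubnP (size w).
elim: n w => // n IHn [|x v] // /ltnSE sv hw.
(* If [v] is constant of even length, [v b] may be a base case of [phi], but then [x v x] is a
   palindrome of even length. *)
case: (boolP (~~ odd (size v) && constant v)) => [/andP[ev cv]|hv].
  have p0 : phi (rcons (x :: v) x) = 0.
    apply: phi_even_palindrome; first by rewrite size_rcons /= negbK.
    exact/rev_cons_rcons_palindrome/constant_palindrome.
  by case: x p0 {sv hw} => ->; rewrite ?mulr0 ?mul0r.
case: v => [|c u] // in sv hw hv *.
have ncv b : ~~ (odd (size (rcons (c :: u) b)) && constant (rcons (c :: u) b)).
  move: hv; rewrite size_rcons /= all_rcons !negbK.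
  by case: odd => //= /negPf->; rewrite andbF.
have ncxv : ~~ (odd (size (x :: c :: u)) && constant (x :: c :: u)).
  move: hv; rewrite /= !negbK; case: odd => //=.
  by apply: contra => /andP[/eqP->].
have ncxvb b : ~~ (odd (size (rcons (x :: c :: u) b)) &&
                   constant (rcons (x :: c :: u) b)).
  move: hw; rewrite size_rcons /= all_rcons !negbK.
  by case: odd => //=; apply: contra => /and3P[-> _].
have stp b : phi (rcons (x :: c :: u) b) =
    Num.sg (Num.sg (phi (rcons u b) - phi (c :: u))
            - Num.sg (phi (c :: u) - phi (del_last (x :: c :: u)))).
  rewrite phi_step // del_last_rcons; congr (Num.sg (_ - _)).
    by rewrite -[del_first _]/(rcons (c :: u) b) phi_step // del_last_rcons.
  exact: phi_step.
rewrite !stp; apply: sg_sub_step; try exact: trit_phi.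
move=> v0; apply: IHn; first exact: ltnW.
(* If [u] were an exception, the core [c :: u] would have a nonzero value. *)
case: (boolP (odd (size u))) => // eu.
apply/negP => /(constantP false)[a ua].
by move: v0; rewrite ua; apply: phi_cons_nseq_even_neq0.
Qed.

Lemma xi_ext_not_opposite w : ~~ odd (size w) ->
  xi (rcons w false) * xi (rcons w true) <> -1.
Proof.
have [n] := ubnP (size w).
elim: n w => // n IHn [|x v] // /ltnSE sv ew.
(* If [v] is a palindrome, so is [x v x]. Otherwise neither [v b] nor [x v] is a base case, nor is
   [x v b], whose length is odd, so the recursion unfolds twice. *)
case: (boolP (rev v == v)) => [/eqP rv|nrv].
  have p0 : xi (rcons (x :: v) x) = 0.
    exact/xi_palindrome/rev_cons_rcons_palindrome.
  by case: x p0 {sv ew} => ->; rewrite ?mulr0 ?mul0r.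
case: v => [|c u] // in sv ew nrv *.
have nav b : ~~ (is_even_T (rcons (c :: u) b) || is_even_CT (rcons (c :: u) b)).
  by apply: contra nrv => /is_even_alt_rcons_palindrome/eqP.
have naxv : ~~ (is_even_T (x :: c :: u) || is_even_CT (x :: c :: u)).
  by apply: contra nrv => /is_even_alt_cons_palindrome/eqP.
have naxvb b : ~~ (is_even_T (rcons (x :: c :: u) b) ||
                   is_even_CT (rcons (x :: c :: u) b)).
  by rewrite /is_even_T /is_even_CT size_rcons [odd _.+1]/= ew !andbF.
have stp b : xi (rcons (x :: c :: u) b) =
    Num.sg (Num.sg (xi (del_last (x :: c :: u)) + xi (c :: u))
            + Num.sg (xi (c :: u) + xi (rcons u b))).
  rewrite xi_step // del_last_rcons; congr (Num.sg (_ + _)).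
    exact: xi_step.
  by rewrite -[del_first _]/(rcons (c :: u) b) xi_step // del_last_rcons.
rewrite !stp; apply: sg_add_step; try exact: trit_xi.
by move=> _; apply: IHn; [exact: ltnW | rewrite /= negbK in ew].
Qed.

Lemma psi_rcons w : colourable (rcons w false) -> colourable (rcons w true) ->
  psi (rcons w false) = psi (rcons w true).
Proof.
rewrite /colourable /psi !size_rcons.
case: (boolP (odd (size w))) => ow.
  (* The extensions have even length, so a nonzero [xi] is raised to 1 and [psi] equals [phi]. *)
  have := phi_ext_not_opposite (w := w); rewrite ow => /(_ isT).
  have sq z : trit z -> z <> 0 -> z ^+ (size w).+1 = 1.
    rewrite -(odd_double_half (size w).+1) /= ow add0n -muln2 mulnC exprM.
    by case=> -> // _; rewrite ?sqrrN !expr1n.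
  move: (sq _ (trit_xi (rcons w false))) (sq _ (trit_xi (rcons w true))).
  case: (xi (rcons w false) =P 0) => [->|/= n0 /(_ n0) ->]; first by rewrite expr0n mul0r.
  case: (xi (rcons w true) =P 0) => [->|/= n1 /(_ n1) ->]; first by rewrite expr0n mul0r.
  by rewrite !mul1r; case: (trit_phi (rcons w false)) => ->; case: (trit_phi (rcons w true)) => ->.
(* The extensions have odd length, so [psi] is the product of [xi] and [phi]. *)
have pw z : trit z -> z ^+ (size w).+1 = z.
  rewrite exprS -(odd_double_half (size w)) (negbTE ow) add0n -muln2 mulnC exprM.
  by case=> ->; rewrite ?mul0r // ?sqrrN !expr1n.
rewrite !pw; try exact: trit_xi.
have xiw := xi_ext_not_opposite ow.
(* The exceptions of [phi_ext_not_opposite] do no harm: if [w] repeats the letter [a], then [w a] is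
   a palindrome and hence not colourable. *)
case: (boolP (constant w)) => [/(constantP false)[a wa]|cw].
  have : xi (rcons w a) = 0.
    apply: xi_palindrome; rewrite wa -cats1 -(nseqD _ 1); exact: rev_nseq.
  by case: a {wa} => ->; rewrite mul0r.
have := @phi_ext_not_opposite w; rewrite cw orbT => /(_ isT).
move: xiw; case: (trit_xi (rcons w false)) => ->; case: (trit_xi (rcons w true)) => -> //;
  by case: (trit_phi (rcons w false)) => ->; case: (trit_phi (rcons w true)) => ->.
Qed.

Theorem theorem7p9 (w : bstring) :
  (colourable (rcons w false) -> colourable (rcons w true) ->
     psi (rcons w false) = psi (rcons w true)) /\
  (colourable (false :: w) -> colourable (true :: w) ->
     psi (false :: w) = psi (true :: w)).
Proof.
split; first exact: psi_rcons.
have psiE b : psi (b :: w) = - psi (rcons (rev w) b) by rewrite -psi_rev rev_rcons revK.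
have nz b : colourable (b :: w) -> colourable (rcons (rev w) b).
  by rewrite /colourable psiE => nz0 z; apply: nz0; rewrite z.
by move=> /nz c0 /nz c1; rewrite !psiE psi_rcons.
Qed.
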